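(* For every graph $G$ of order $n$, we have $\textnormal{ftldim}(G)<n$ if and only if there exists $v\in V(G)$ such that for all $u\in V(G)$ with $\{u,v\}\in E(G)$ we have $N(u)-\{v\}\ne N(v)-\{u\}$.
   Context: Graphs are finite, simple, undirected, possibly disconnected; $\textnormal{dist}(u,v)=\infty$ between different components; $N(x)$ is the neighborhood of $x$. A set $S=\{v_1,\dots,v_k\}$ of vertices is a local resolving set of $G$ if $(\textnormal{dist}(u,v_1),\dots,\textnormal{dist}(u,v_k))\ne(\textnormal{dist}(w,v_1),\dots,\textnormal{dist}(w,v_k))$ for every edge $\{u,w\}\in E(G)$. The fault-tolerant local metric dimension $\textnormal{ftldim}(G)$ is the minimum size of a nonempty $S\subseteq V(G)$ such that $S-\{s\}$ is a local resolving set for every $s\in S$.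
   Formalization: The one-vertex graph is excluded (order n ≠ 1): there ftldim(G) = 1 = n because S must be nonempty, while the condition on v holds vacuously, so the equivalence fails for that graph only. *)

(* Defs.v *)
From mathcomp Require Import all_boot.
Set Implicit Arguments.
Unset Strict Implicit.
Unset Printing Implicit Defensive.

Record sgraph := SGraph {
  vert :> finType;
  adj : rel vert;
  adj_sym : symmetric adj;
  adj_irrefl : irreflexive adj }.

Definition nbhd (G : sgraph) (x : G) : {set G} := [set y | adj x y].

Definition walk (G : sgraph) (k : nat) (u v : G) : bool :=
  [exists p : k.-tuple G, path (@adj G) u p && (last u p == v)].

Lemma connect_walk (G : sgraph) (u v : G) :
  connect (@adj G) u v -> exists k, walk k u v.
Proof.
case/connectP=> p pth_p ->; exists (size p).
by apply/existsP; exists (in_tuple p); rewrite pth_p eqxx.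
Qed.

(* None stands for an infinite distance. *)
Definition dist (G : sgraph) (u v : G) : option nat :=
  if @idP (connect (@adj G) u v) is ReflectT cuv
  then Some (ex_minn (connect_walk cuv)) else None.

Definition dist_vec (G : sgraph) (S : {set G}) (u : G) : seq (option nat) :=
  [seq dist u v | v <- enum S].

(* S = set0 is allowed: it is local resolving exactly when G has no edge. *)
Definition local_resolving (G : sgraph) (S : {set G}) : bool :=
  [forall u, forall w, adj u w ==> (dist_vec S u != dist_vec S w)].

Definition ft_local_resolving (G : sgraph) (S : {set G}) : bool :=
  (S != set0) && [forall s in S, local_resolving (S :\ s)].

Lemma dist_eq0 (G : sgraph) (u v : G) : (dist u v == Some 0) = (u == v).
Proof.
rewrite /dist; case: {-}_ / idP => [c|c].
  case: ex_minnP => k wk mk; apply/eqP/eqP => [[k0]|uv].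
    move: wk; rewrite k0 => /existsP[p /andP[_ /eqP]].
    by rewrite tuple0.
  congr Some; apply/eqP; rewrite -leqn0; apply: mk.
  by apply/existsP; exists [tuple]; rewrite /= uv.
by apply/esym/eqP => uv; apply: c; rewrite uv connect0.
Qed.

Lemma dist_vec_eq (G : sgraph) (S : {set G}) (u w : G) :
  reflect {in S, dist u =1 dist w} (dist_vec S u == dist_vec S w).
Proof.
apply: (iffP eqP) => [/eq_in_map h x xS|h].
  by apply: h; rewrite mem_enum.
by apply/eq_in_map => x; rewrite mem_enum; apply: h.
Qed.

Lemma ft_local_resolvingT (G : sgraph) :
  0 < #|G| -> ft_local_resolving [set: G].
Proof.
move=> G0; rewrite /ft_local_resolving -card_gt0 cardsT G0 /=.
apply/forall_inP => s _; apply/forallP => u; apply/forallP => w.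
apply/implyP => uw; apply/negP => /dist_vec_eq h.
have uNw : u != w by apply: contraTneq uw => ->; rewrite adj_irrefl.
have [us|us] := eqVneq u s.
  have := h w; rewrite !inE -us eq_sym uNw => /(_ isT) /eqP.
  have /eqP -> : dist w w == Some 0 by rewrite dist_eq0.
  by rewrite dist_eq0 (negPf uNw).
have := h u; rewrite !inE us => /(_ isT)/esym/eqP.
have /eqP -> : dist u u == Some 0 by rewrite dist_eq0.
by rewrite dist_eq0 eq_sym (negPf uNw).
Qed.

(* By ft_local_resolvingT this is a genuine minimum as soon as G has a
   vertex; the graph without vertices gets the value 0.
   For the one-vertex graph the only candidate is S = V(G), so ftldim = 1. *)
Definition ftldim (G : sgraph) : nat :=
  #|[arg min_(S < [set: G] | ft_local_resolving S) #|S| ]|.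

Lemma ftldimP (G : sgraph) : 0 < #|G| ->
  (exists2 S : {set G}, ft_local_resolving S & #|S| = ftldim G) /\
  (forall S : {set G}, ft_local_resolving S -> ftldim G <= #|S|).
Proof.
move=> /ft_local_resolvingT ftT; rewrite /ftldim.
by case: arg_minnP => // S ftS minS; split=> //; exists S.
Qed.

(* Main.v *)
(** The property of being fault-tolerant is inherited by supersets, so
    ftldim(G) < n iff some V - {v} is fault-tolerant.  A vertex resolves every
    edge at which it lies, so after removing v and s only an edge {v, s} can
    fail to be resolved; it fails exactly when v and s are true twins, since
    true twins have equal distances to all other vertices, while a vertex
    adjacent to only one of v, s is at distance 1 from only that one. *)
Require Import Defs.
From mathcomp Require Import all_boot.
Set Implicit Arguments.
Unset Strict Implicit.

(** Characterises distance by walks alone, so that later arguments never open the dependent match on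
    [connect]. *)
Lemma distP (G : sgraph) (u v : G) :
  if dist u v is Some k then walk k u v /\ forall j, walk j u v -> k <= j
  else forall k, ~~ walk k u v.
Proof.
rewrite /dist; case: {-}_ / idP => [c|c]; first by case: ex_minnP.
move=> k; apply: contra_notN c => /existsP[p /andP[pth /eqP lst]].
by apply/connectP; exists p.
Qed.

(** Walks that are no longer suffice: they bound the two minima by each other, and they rule out
    that only one distance is infinite. *)
Lemma eq_dist (G : sgraph) (u w x : G) :
  (forall k, walk k u x -> exists2 j, j <= k & walk j w x) ->
  (forall k, walk k w x -> exists2 j, j <= k & walk j u x) ->
  dist u x = dist w x.
Proof.
move=> uw wu; have := distP u x; have := distP w x.
case: (dist w x) => [k [wk mink]|noW]; case: (dist u x) => [l [ul minl]|noU] //.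
- have [i ik ui] := wu _ wk; have [j jl wj] := uw _ ul.
  congr Some; apply/eqP; rewrite eqn_leq.
  by rewrite (leq_trans (minl _ ui) ik) (leq_trans (mink _ wj) jl).
- by have [i _ ui] := wu _ wk; have := noU i; rewrite ui.
- by have [j _ wj] := uw _ ul; have := noW j; rewrite wj.
Qed.

Lemma walk0 (G : sgraph) (u v : G) : walk 0 u v = (u == v).
Proof.
apply/existsP/eqP => [[p /andP[_ /eqP]]|->]; first by rewrite tuple0.
by exists [tuple]; rewrite /= eqxx.
Qed.

Lemma walkS (G : sgraph) (k : nat) (u v : G) :
  walk k.+1 u v = [exists y, adj u y && walk k y v].
Proof.
apply/existsP/existsP => [[p]|[y /andP[uy /existsP[p pP]]]].
  case/tupleP: p => y p /= /andP[/andP[uy pth] lst]; exists y.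
  by rewrite uy; apply/existsP; exists p; rewrite pth.
by exists [tuple of y :: p]; rewrite /= uy.
Qed.

Lemma dist_eq1 (G : sgraph) (u v : G) : (dist u v == Some 1) = adj u v.
Proof.
have walk1 : walk 1 u v = adj u v.
  rewrite walkS; apply/existsP/idP => [[y]|uv]; last first.
    by exists v; rewrite uv walk0 eqxx.
  by rewrite walk0 => /andP[uy /eqP <-].
rewrite -walk1; have := distP u v; case E: (dist u v) => [k|] => [[wk mink]|noW].
  apply/eqP/idP => [[<-] //|w1].
  have : k <= 1 by apply: mink.
  rewrite leq_eqVlt ltnS leqn0 => /orP[/eqP-> //|/eqP k0].
  (* If the minimum were 0, then [u = v] and the walk of length 1 would be a loop. *)
  move: wk w1; rewrite k0 walk0 => /eqP ->.
  rewrite walkS => /existsP[y]; rewrite walk0 => /andP[vy /eqP yv].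
  by rewrite yv adj_irrefl in vy.
by rewrite (negPf (noW 1)).
Qed.

(** If the first step goes to [w], drop it; otherwise it goes to a common neighbour of the twins,
    and [w] can replace [u] as the start. The condition [x != u] excludes the empty walk, which has
    no first step. *)
Lemma walk_twin (G : sgraph) (u w x : G) (k : nat) :
  nbhd u :\ w = nbhd w :\ u -> x != u ->
  walk k u x -> exists2 j, j <= k & walk j w x.
Proof.
case: k => [|k] Nuw xu; first by rewrite walk0 eq_sym (negPf xu).
rewrite walkS => /existsP[y /andP[uy yx]].
have [<-|yw] := eqVneq y w; first by exists k.
exists k.+1 => //; rewrite walkS; apply/existsP; exists y; rewrite yx andbT.
have : y \in nbhd w :\ u by rewrite -Nuw !inE yw.
by rewrite !inE => /andP[].
Qed.

Lemma dist_twin (G : sgraph) (u w x : G) :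
  nbhd u :\ w = nbhd w :\ u -> x != u -> x != w -> dist u x = dist w x.
Proof.
move=> Nuw xu xw; apply: eq_dist => k; first exact: walk_twin.
exact: walk_twin (esym Nuw) xw.
Qed.

Lemma local_resolvingS (G : sgraph) (S T : {set G}) :
  S \subset T -> local_resolving S -> local_resolving T.
Proof.
move=> /subsetP ST /forallP resS; apply/forallP => u; apply/forallP => w.
apply/implyP => uw; have /forallP/(_ w)/implyP/(_ uw) := resS u.
by apply: contra => /dist_vec_eq h; apply/dist_vec_eq => x /ST; apply: h.
Qed.

Lemma ft_local_resolvingS (G : sgraph) (S T : {set G}) :
  S \subset T -> ft_local_resolving S -> ft_local_resolving T.
Proof.
move=> ST /andP[/set0Pn[s0 s0S] /forall_inP ftS]; apply/andP; split.
  by apply/set0Pn; exists s0; apply: (subsetP ST).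
apply/forall_inP => t _; have [tS|tS] := boolP (t \in S).
  exact: local_resolvingS (setSD _ ST) (ftS t tS).
(* For [t] outside [S], the set [T :\ t] still contains all of [S], hence the resolving set
   [S :\ s0]. *)
apply: local_resolvingS (ftS s0 s0S); apply: subset_trans (subD1set _ _) _.
by rewrite subsetD1 ST.
Qed.

Lemma dist_neq_self (G : sgraph) (u w : G) : adj u w -> dist u u <> dist w u.
Proof.
move=> uw h; have := dist_eq0 w u; rewrite -h dist_eq0 eqxx => /esym/eqP wu.
by move: uw; rewrite wu adj_irrefl.
Qed.

Lemma ft_local_resolving_setC1 (G : sgraph) (v : G) : 1 < #|G| ->
  ft_local_resolving [set~ v] <->
  forall u : G, adj u v -> nbhd u :\ v <> nbhd v :\ u.
Proof.
move=> G1; have C0 : [set~ v] != set0 by rewrite -card_gt0 cardsC1 -subn1 subn_gt0.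
rewrite /ft_local_resolving C0 /=; split=> [/forall_inP ft u uv Nuv|noTwin].
  have uNv : u != v by apply: contraTneq uv => ->; rewrite adj_irrefl.
  (* Removing [u] as well leaves only vertices other than the twins, and none of these separates
     them. *)
  have /ft/forallP/(_ u)/forallP/(_ v) : u \in [set~ v] by rewrite !inE.
  rewrite uv => /negP; apply; apply/dist_vec_eq => x.
  by rewrite !inE => /andP[xu xv]; apply: dist_twin.
apply/forall_inP => s; rewrite !inE => sNv.
apply/forallP => u; apply/forallP => w; apply/implyP => uw.
apply/negP => /dist_vec_eq h.
have uI : (u == s) || (u == v).
  apply/negPn/negP; rewrite negb_or => /andP[us uv].
  by apply: (dist_neq_self uw); apply: h; rewrite !inE us uv.
have wI : (w == s) || (w == v).
  apply/negPn/negP; rewrite negb_or => /andP[ws wv].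
  have wu : adj w u by rewrite adj_sym.
  by apply: (dist_neq_self wu); rewrite h // !inE ws wv.
(* Both ends lie in {s, v} and there are no loops, so the unresolved edge can be oriented from [s]
   to [v]. *)
have [sv hs] : adj s v /\ {in [set~ v] :\ s, dist s =1 dist v}.
  case/orP: uI uw h => /eqP->; case/orP: wI => /eqP-> ab h.
  - by rewrite adj_irrefl in ab.
  - by [].
  - by rewrite adj_sym; split=> // x xS; rewrite h.
  - by rewrite adj_irrefl in ab.
apply: (noTwin s sv); apply/setP => x; rewrite !inE.
have [->|xv] := eqVneq x v; first by rewrite adj_irrefl andbF.
have [->|xs] := eqVneq x s; first by rewrite adj_irrefl.
(* Adjacency is distance 1, so equal distances give equal neighbourhoods. *)
by rewrite /= -!dist_eq1 hs // !inE xs xv.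
Qed.

Theorem theorem27 (G : sgraph) (n : nat) (hn : #|G| = n) (hn1 : n <> 1) :
  ftldim G < n <->
  exists v : G, forall u : G, adj u v -> nbhd u :\ v <> nbhd v :\ u.
Proof.
(* For n = 0 both sides fail. For n = 1 the equivalence is false: [ftldim] is 1, while the isolated
   vertex satisfies the right side vacuously; [hn1] excludes this case. *)
case: n hn hn1 => [|[|n]] hn // _.
  by split=> // -[v _]; have := fintype0 v hn.
have G1 : 1 < #|G| by rewrite hn.
have [[S ftS cardS] minS] := ftldimP (ltnW G1).
split=> [lt_n|[v /(ft_local_resolving_setC1 _ G1) ftv]]; last first.
  by apply: leq_ltn_trans (minS _ ftv) _; rewrite cardsC1 hn.
have [v vS] : exists v, v \notin S.
  apply/existsP; apply: contraLR lt_n; rewrite negb_exists => /forallP SV.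
  rewrite -leqNgt -cardS -hn -cardsT subset_leq_card //.
  by apply/subsetP => x _; have := SV x; rewrite negbK.
exists v; apply/(ft_local_resolving_setC1 _ G1).
by apply: ft_local_resolvingS ftS; rewrite subsetC sub1set inE.
Qed.
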